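(* Let $\gamma\in\mathbb{R}$, let $\Phi_\gamma$ be the classical extreme value distribution function and $\Psi_\gamma$ the free extreme value distribution function with parameter $\gamma$. Put $a_n=1$, $b_n=\log n$ if $\gamma=0$, and $a_n=n^{1/\gamma}$, $b_n=0$ if $\gamma\neq 0$. Then for all $n\in\mathbb{N}$, $n\ge 1$, $$d_K\big(\Phi_\gamma^{\Box\!\!\!\lor\, n}(a_n\,\cdot+b_n),\Psi_\gamma\big)\le\frac1n .$$
   Context: Classical extreme value distributions: $\Phi_0(x)=\exp(-e^{-x})$ for $x\in\mathbb{R}$; for $\gamma>0$, $\Phi_\gamma(x)=\exp(-x^{-\gamma})\mathbb{1}_{(0,\infty)}(x)$; for $\gamma<0$, $\Phi_\gamma(x)=\exp(-|x|^{-\gamma})\mathbb{1}_{(-\infty,0)}(x)+\mathbb{1}_{[0,\infty)}(x)$. Free extreme value distributions: $\Psi_0(x)=(1-e^{-x})\mathbb{1}_{[0,\infty)}(x)$; for $\gamma>0$, $\Psi_\gamma(x)=(1-x^{-\gamma})\mathbb{1}_{[1,\infty)}(x)$; for $\gamma<0$, $\Psi_\gamma(x)=(1-|x|^{-\gamma})\mathbb{1}_{[-1,0]}(x)+\mathbb{1}_{(0,\infty)}(x)$. Here $\mathbb{1}_B$ is the indicator function of $B$. For a distribution function $F$ on $\mathbb{R}$, its $n$-fold free max-convolution is $F^{\Box\!\!\!\lor\, n}=\max\{nF-(n-1),0\}$. The expression $F^{\Box\!\!\!\lor\, n}(a_n\,\cdot+b_n)$ denotes the function $x\mapsto F^{\Box\!\!\!\lor\,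 n}(a_nx+b_n)$. The Kolmogorov distance is $d_K(F_1,F_2)=\sup_{x\in\mathbb{R}}|F_1(x)-F_2(x)|$. *)

(* Defs.v *)
From mathcomp Require Import all_boot all_order all_algebra.
From mathcomp Require Import all_classical all_reals all_analysis.

Set Implicit Arguments.
Unset Strict Implicit.
Unset Printing Implicit Defensive.

Import Order.TTheory GRing.Theory Num.Theory.
Local Open Scope classical_set_scope.
Local Open Scope ring_scope.

(* Junk values of [`^] at a nonpositive base (or of [x `^ (- g)] at x = 0 for
   g > 0) are always multiplied by an indicator equal to 0; the only base 0 that
   counts is |0| in the g < 0 branch of [free_evd], where 0 `^ (- g) = 0. *)
Definition classical_evd (R : realType) (g : R) (x : R) : R :=
  if g == 0 then expR (- expR (- x))
  else if 0 < g then expR (- (x `^ (- g))) * \1_(`]0, +oo[%classic : set R) x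
  else expR (- (`|x| `^ (- g))) * \1_(`]-oo, 0[%classic : set R) x
       + \1_(`[0, +oo[%classic : set R) x.

Definition free_evd (R : realType) (g : R) (x : R) : R :=
  if g == 0 then (1 - expR (- x)) * \1_(`[0, +oo[%classic : set R) x
  else if 0 < g then (1 - x `^ (- g)) * \1_(`[1, +oo[%classic : set R) x
  else (1 - `|x| `^ (- g)) * \1_(`[-1, 0]%classic : set R) x
       + \1_(`]0, +oo[%classic : set R) x.

Definition free_max_conv (R : realType) (n : nat) (F : R -> R) (x : R) : R :=
  Num.max (n%:R * F x - (n%:R - 1)) 0.

(* The supremum is taken in the extended reals, so that a bound on it is a
   genuine bound: the real-valued [sup] is 0 on sets without a supremum. *)
Definition kolmogorov_dist (R : realType) (F1 F2 : R -> R) : \bar R :=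
  ereal_sup (range (fun x : R => (`|F1 x - F2 x|)%:E)).

Definition norm_scale (R : realType) (g : R) (n : nat) : R :=
  if g == 0 then 1 else n%:R `^ (1 / g).

Definition norm_shift (R : realType) (g : R) (n : nat) : R :=
  if g == 0 then ln n%:R else 0.

(* Main.v *)
Require Import Defs.
From mathcomp Require Import all_boot all_order all_algebra.
From mathcomp Require Import all_classical all_reals all_analysis.
From mathcomp Require Import ring lra.

Import Order.TTheory GRing.Theory Num.Theory.
Local Open Scope ring_scope.

(** The classical and the free law are functions of one exponent: wherever
    [classical_evd g x] is neither 0 nor 1 there is [u >= 0], namely
    [expR (- x)], [x `^ (- g)] or [`|x| `^ (- g)] according to the sign of [g],
    with [classical_evd g x = expR (- u)] and [free_evd g x = max (1 - u) 0].
    The normalisation is the one for which the classical laws are max-stable: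
    it divides [u] by [n].  Where the classical law is 0 or 1, the normalised
    function and the free law take that same value.  So everything reduces to
    [|max (n * e^(-u/n) - (n - 1)) 0 - max (1 - u) 0| <= 1/n],
    which is [dist_free_max_conv_expR].  It is the statement that the tangent
    line [1 - t] approximates [e^(-t)] at [t = u/n] with an error of at most
    [t^2]; for [u <= 1], multiplication by [n] turns this error into at most
    [1/n]. *)

(** The reciprocal of [1 + t <= expR t], combined with
    [(1 + t) * (1 - t + t ^+ 2) = 1 + t ^+ 3]. *)
Lemma expRN_le_quadratic (R : realType) (t : R) :
  0 <= t -> expR (- t) <= 1 - t + t ^+ 2.
Proof.
move=> t0; have t1 : 0 < 1 + t by rewrite ltr_pwDl.
rewrite expRN; apply: (@le_trans _ _ (1 + t)^-1).
  by rewrite lef_pV2 ?posrE ?expR_gt0 // expR_ge1Dx.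
rewrite -[leLHS]mul1r ler_pdivrMr //.
have -> : (1 - t + t ^+ 2) * (1 + t) = 1 + t ^+ 3 by ring.
by rewrite lerDl exprn_ge0.
Qed.

Lemma free_max_conv_eq1 (R : realType) (n : nat) (F : R -> R) (x : R) :
  F x = 1 -> free_max_conv n F x = 1.
Proof. by rewrite /free_max_conv => ->; rewrite mulr1 subKr max_l. Qed.

Lemma free_max_conv_eq0 (R : realType) (n : nat) (F : R -> R) (x : R) :
  (1 <= n)%N -> F x = 0 -> free_max_conv n F x = 0.
Proof.
move=> n1; rewrite /free_max_conv => ->.
by rewrite mulr0 sub0r max_r // oppr_le0 subr_ge0 ler1n.
Qed.

(** On [0 <= u <= 1] the bound is the second-order estimate of [expR] at
    [- (u / n)], multiplied by [n].  For [u >= 1] the second maximum is 0 while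
    the first one is nonincreasing in [u], so its value at [u = 1] bounds it. *)
Lemma dist_free_max_conv_expR (R : realType) (n : nat) (F : R -> R) (x u : R) :
    (1 <= n)%N -> 0 <= u -> F x = expR (- (u / n%:R)) ->
  `|free_max_conv n F x - Num.max (1 - u) 0| <= 1 / n%:R.
Proof.
move=> n1 u0; rewrite /free_max_conv => ->.
have n0 : 0 < n%:R :> R by rewrite ltr0n.
have nV0 : 0 <= n%:R^-1 :> R by rewrite invr_ge0 ltW.
set A := n%:R * _ - _.
have lower : 1 - u <= A.
  have := expR_ge1Dx (- (u / n%:R)).
  rewrite -(ler_pM2l n0) mulrDr mulrN mulr1 mulrCA divff ?gt_eqF // mulr1.
  by rewrite /A; lra.
have upper (v : R) : 0 <= v <= 1 ->
    n%:R * expR (- (v / n%:R)) - (n%:R - 1) <= 1 - v + n%:R^-1.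
  move=> /andP[v0 v1].
  have := @expRN_le_quadratic _ (v / n%:R).
  rewrite mulr_ge0 // => /(_ isT); rewrite -(ler_pM2l n0).
  have -> : n%:R * (1 - v / n%:R + (v / n%:R) ^+ 2)
            = n%:R - v + v ^+ 2 * n%:R^-1 by field; rewrite gt_eqF.
  have : v ^+ 2 * n%:R^-1 <= n%:R^-1 by rewrite ler_piMl // exprn_ile1.
  by lra.
rewrite div1r; have [u1|/ltW u1] := leP u 1.
  have uA : A <= 1 - u + n%:R^-1 by rewrite /A upper // u0.
  rewrite (max_l (_ : 0 <= 1 - u)) ?subr_ge0 // max_l; last by lra.
  by rewrite ger0_norm; lra.
have A1 : A <= n%:R^-1.
  have := upper 1; rewrite ler01 lexx => /(_ isT).
  rewrite subrr add0r; apply: le_trans; rewrite lerD2r ler_pM2l //.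
  by rewrite ler_expR lerN2 ler_wpM2r.
rewrite (max_r (_ : 1 - u <= 0)) ?subr_le0 // subr0.
by rewrite ger0_norm ?ge_max ?A1 // le_max lexx orbT.
Qed.

(** Max-stability of the power laws: scaling the argument by [n `^ (1 / g)]
    divides the exponent [y `^ (- g)] by [n]. *)
Lemma powRN_norm_scale (R : realType) (n : nat) (g y : R) :
    (1 <= n)%N -> g != 0 -> 0 <= y ->
  (n%:R `^ (1 / g) * y) `^ (- g) = y `^ (- g) / n%:R.
Proof.
move=> n1 g0 y0; rewrite powRM ?powR_ge0 // -powRrM mulrN div1r mulVf //.
by rewrite powR_inv1 // mulrC.
Qed.

Lemma powR_le1 (R : realType) (a y : R) : 0 <= a -> 0 <= y <= 1 -> y `^ a <= 1.
Proof.
move=> a0 /andP[y0 y1].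
by have := @ge0_ler_powR _ _ a0 y 1; rewrite powR1 !nnegrE; apply.
Qed.

Lemma powR_ge1 (R : realType) (a y : R) : 0 <= a -> 1 <= y -> 1 <= y `^ a.
Proof.
move=> a0 y1.
have := @ge0_ler_powR _ _ a0 1 y; rewrite powR1 !nnegrE; apply=> //.
exact: le_trans y1.
Qed.

(** The lower endpoint of the support of each free law is the point where the
    exponent equals 1, so the indicator amounts to a positive part. *)
Lemma free_evd_gumbel (R : realType) (x : R) :
  free_evd 0 x = Num.max (1 - expR (- x)) 0.
Proof.
rewrite /free_evd eqxx indicE; have [x0|x0] := leP 0 x.
  rewrite mem_set /= ?in_itv /= ?x0 // mulr1 max_l // subr_ge0.
  by rewrite -expR0 ler_expR lerNl oppr0.
rewrite memNset /= ?in_itv /= ?leNgt ?x0 // mulr0 max_r //.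
by rewrite subr_le0 -expR0 ler_expR lerNr oppr0 ltW.
Qed.

Lemma classical_evd_frechet (R : realType) (g x : R) : 0 < g -> 0 < x ->
  classical_evd g x = expR (- (x `^ (- g))).
Proof.
move=> g0 x0; rewrite /classical_evd gt_eqF // g0 indicE.
by rewrite mem_set ?mulr1 //= in_itv /= x0.
Qed.

Lemma classical_evd_frechet0 (R : realType) (g x : R) : 0 < g -> x <= 0 ->
  classical_evd g x = 0.
Proof.
move=> g0 x0; rewrite /classical_evd gt_eqF // g0 indicE.
by rewrite memNset ?mulr0 //= in_itv /= ltNge x0.
Qed.

Lemma free_evd_frechet (R : realType) (g x : R) : 0 < g -> 0 < x ->
  free_evd g x = Num.max (1 - x `^ (- g)) 0.
Proof.
move=> g0 x0; rewrite /free_evd gt_eqF // g0 indicE powRN.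
have [x1|x1] := leP 1 x.
  rewrite mem_set /= ?in_itv /= ?x1 // mulr1 max_l // subr_ge0.
  by rewrite invf_le1 ?powR_gt0 // powR_ge1 // ltW.
rewrite memNset /= ?in_itv /= ?leNgt ?x1 // mulr0 max_r // subr_le0.
by rewrite invf_ge1 ?powR_gt0 // powR_le1 // ?ltW.
Qed.

Lemma free_evd_frechet0 (R : realType) (g x : R) : 0 < g -> x <= 0 ->
  free_evd g x = 0.
Proof.
move=> g0 x0; rewrite /free_evd gt_eqF // g0 indicE.
rewrite memNset ?mulr0 //= in_itv /= andbT => x1.
by have := le_trans x1 x0; rewrite ler10.
Qed.

Lemma classical_evd_weibull (R : realType) (g x : R) : g < 0 -> x < 0 ->
  classical_evd g x = expR (- (`|x| `^ (- g))).
Proof.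
move=> g0 x0; rewrite /classical_evd lt_eqF // ltNge (ltW g0) /= !indicE.
rewrite mem_set /= ?in_itv //= memNset /= ?in_itv /= ?leNgt ?x0 //.
by rewrite mulr1 addr0.
Qed.

Lemma classical_evd_weibull1 (R : realType) (g x : R) : g < 0 -> 0 <= x ->
  classical_evd g x = 1.
Proof.
move=> g0 x0; rewrite /classical_evd lt_eqF // ltNge (ltW g0) /= !indicE.
rewrite memNset /= ?in_itv /= ?ltNge ?x0 // mem_set /= ?in_itv /= ?x0 //.
by rewrite mulr0 add0r.
Qed.

Lemma free_evd_weibull (R : realType) (g x : R) : g < 0 -> x < 0 ->
  free_evd g x = Num.max (1 - `|x| `^ (- g)) 0.
Proof.
move=> g0 x0; rewrite /free_evd lt_eqF // ltNge (ltW g0) /= !indicE.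
have gN0 : 0 <= - g by rewrite oppr_ge0 ltW.
rewrite (@memNset _ `]0, +oo[%classic) /= ?in_itv /= ?ltNge ?(ltW x0) // addr0.
have [x1|x1] := leP (-1) x.
  rewrite mem_set /= ?in_itv /= ?x1 ?ltW // mulr1 max_l // subr_ge0.
  by rewrite powR_le1 // normr_ge0 ltr0_norm // lerNl.
rewrite memNset /= ?in_itv /= ?leNgt ?x1 // mulr0 max_r // subr_le0.
by rewrite powR_ge1 // ltr0_norm // lerNr ltW.
Qed.

Lemma free_evd_weibull1 (R : realType) (g x : R) : g < 0 -> 0 <= x ->
  free_evd g x = 1.
Proof.
move=> g0 x0; rewrite /free_evd lt_eqF // ltNge (ltW g0) /= !indicE.
move: x0; rewrite le_eqVlt; case/predU1P => [<-|x0].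
  (* At 0 the value comes from the indicator of [-1, 0], as 0 `^ (- g) = 0. *)
  rewrite mem_set /= ?in_itv /= ?lexx ?lerN10 // memNset /= ?in_itv /= ?ltxx //.
  by rewrite normr0 powR0 ?oppr_eq0 ?lt_eqF // subr0 mulr1 addr0.
rewrite memNset /= ?in_itv /= ?(leNgt x) ?x0 ?andbF //.
by rewrite mem_set /= ?in_itv /= ?x0 // mulr0 add0r.
Qed.

Theorem mainTheorem4 (R : realType) (g : R) (n : nat) (hn : (1 <= n)%N) :
  (kolmogorov_dist
     (fun x : R =>
        free_max_conv n (classical_evd g) (norm_scale g n * x + norm_shift g n))
     (free_evd g)
   <= (1 / n%:R)%:E)%E.
Proof.
apply/ereal_supP => _ [x _ <-]; rewrite lee_fin /norm_scale /norm_shift.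
have n0 : 0 < n%:R :> R by rewrite ltr0n.
have dist0 : `|0 : R| <= 1 / n%:R :> R by rewrite normr0 divr_ge0 // ltW.
have [->|gN0] := eqVneq g 0.
  rewrite mul1r free_evd_gumbel; apply: dist_free_max_conv_expR => //.
  by rewrite /classical_evd eqxx opprD expRD (expRN (ln _)) lnK.
rewrite addr0; set a := _ `^ _; have a0 : 0 < a by rewrite powR_gt0.
move: (gN0); rewrite neq_lt => /orP[g0|g0].
  have [x0|x0] := leP 0 x.
    rewrite free_evd_weibull1 // free_max_conv_eq1 ?subrr //.
    by rewrite classical_evd_weibull1 // mulr_ge0 // ltW.
  rewrite free_evd_weibull //; apply: dist_free_max_conv_expR => //.
  rewrite classical_evd_weibull ?pmulr_rlt0 // normrM (gtr0_norm a0).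
  by rewrite powRN_norm_scale.
have [x0|x0] := leP x 0.
  rewrite free_evd_frechet0 // free_max_conv_eq0 ?subrr //.
  by rewrite classical_evd_frechet0 // pmulr_rle0.
rewrite free_evd_frechet //; apply: dist_free_max_conv_expR => //.
  exact: powR_ge0.
by rewrite classical_evd_frechet ?mulr_gt0 // powRN_norm_scale // ltW.
Qed.
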